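(* Let $K$ be a commutative ring, $A$ a $K$-algebra, let $\mathrm{Qcoh}(X)$ consist of $A$-bimodules symmetric over $K$, let $\mathrm{Qcoh}(Y)$ consist of symmetric $K$-bimodules, and let $f:X\to Y$ be given by $f^*=A\otimes_K(-)$ (with right adjoint $f_*$). Let $\mathcal{F}:=\mathrm{Hom}_K(M,N)$ for some left $A$-modules $M,N$. Then $\mathcal{F}_f=\mathrm{Diff}^{A/K}(M,N)$.
   Context: For a morphism $f:X\to Y$ given by an adjoint pair $f^*\dashv f_*$ between abelian categories $\mathrm{Qcoh}(Y)$, $\mathrm{Qcoh}(X)$ (with $\mathrm{Qcoh}(X)$ cocomplete) and $\mathcal{F}\in\mathrm{Qcoh}(X)$, define inductively a tower of quotients of $\mathcal{F}$: $\mathcal{F}^0:=\mathcal{F}$ and $\mathcal{F}^{p+1}:=\mathrm{coker}(f^*f_*\mathcal{F}^p\to\mathcal{F}^p)$, the arrow being the counit of the adjunction. Put $\mathcal{F}_p:=\ker(\mathcal{F}\to\mathcal{F}^{p+1})$, an increasing filtration of $\mathcal{F}$, and $\mathcal{F}_f:=\mathrm{colim}_p\,\mathcal{F}_p$. $\mathrm{Hom}_K(M,N)$ is an $A$-bimodule by $(a\varphi b)(m)=a\varphi(bm)$. $\mathrm{Diff}^{A/K}(M,N)$ denotes differential operators in the sense of Lunts–Rosenberg: for an $A$-bimodule $\mathcal{F}$ symmetric over $K$, put $\mathcal{F}_{-1}^{\mathrm{diff}}=0$ and let $\mathcal{F}_p^{\mathrm{diff}}\subset\mathcal{F}$ be the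 sub-bimodule containing $\mathcal{F}_{p-1}^{\mathrm{diff}}$ such that $\mathcal{F}_p^{\mathrm{diff}}/\mathcal{F}_{p-1}^{\mathrm{diff}}$ is the sub-$A$-bimodule of $\mathcal{F}/\mathcal{F}_{p-1}^{\mathrm{diff}}$ generated by its center $Z_A(\mathcal{F}/\mathcal{F}_{p-1}^{\mathrm{diff}})=\{x: ax=xa\ \forall a\in A\}$. For $\mathcal{F}=\mathrm{Hom}_K(M,N)$, $\mathrm{Diff}^{A/K}_p(M,N):=\mathcal{F}_p^{\mathrm{diff}}$ and $\mathrm{Diff}^{A/K}(M,N):=\bigcup_p\mathrm{Diff}^{A/K}_p(M,N)$. *)

(* Defs.v *)
From HB Require Import structures.
From mathcomp Require Import all_boot all_order all_algebra.
From mathcomp Require Import generic_quotient ring_quotient.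
From mathcomp Require Import boolp classical_sets.

#[local] Obligation Tactic := try by [].
Set Implicit Arguments.
Unset Strict Implicit.
Unset Printing Implicit Defensive.

Import GRing.Theory.
Local Open Scope ring_scope.
Local Open Scope quotient_scope.
Local Open Scope classical_set_scope.

(* The filtration only needs kernels, cokernels and sequential colimits, all   *)
(* of which a cocomplete abelian category has. The categories below therefore  *)
(* record zero morphisms rather than the whole additive structure, and         *)
(* filt_category adds a choice of these (co)limits.                            *)

Record category := Category {
  obj :> Type;
  hom : obj -> obj -> Type;
  idm : forall X, hom X X;
  comp : forall X Y Z, hom Y Z -> hom X Y -> hom X Z;
  zerom : forall X Y, hom X Y;
  comp_idl : forall X Y (f : hom X Y), comp (idm Y) f = f;
  comp_idr : forall X Y (f : hom X Y), comp f (idm X) = f;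
  compA : forall X Y Z T (h : hom Z T) (g : hom Y Z) (f : hom X Y),
    comp h (comp g f) = comp (comp h g) f;
  comp0l : forall X Y Z (f : hom X Y), comp (zerom Y Z) f = zerom X Z;
  comp0r : forall X Y Z (g : hom Y Z), comp g (zerom X Y) = zerom X Z }.

Arguments hom {_} _ _.
Arguments idm {_} _.
Arguments comp {_ _ _ _} _ _.
Arguments zerom {_} _ _.

Declare Scope cat_scope.
Delimit Scope cat_scope with cat.
Notation "g '\oc' f" := (comp g f) (at level 40, left associativity) : cat_scope.
Local Open Scope cat_scope.

Record functor (C D : category) := Functor {
  fobj :> C -> D;
  fmap : forall X Y : C, hom X Y -> hom (fobj X) (fobj Y);
  fmap_id : forall X : C, fmap (idm X) = idm (fobj X);
  fmap_comp : forall (X Y Z : C) (g : hom Y Z) (f : hom X Y),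
    fmap (g \oc f) = fmap g \oc fmap f }.

Arguments fmap {_ _} _ {_ _} _.

Record adjunction (C D : category) (L : functor D C) (R : functor C D) :=
  Adjunction {
  unit_ : forall Y : D, hom Y (R (L Y));
  counit : forall X : C, hom (L (R X)) X;
  unit_nat : forall (Y Y' : D) (f : hom Y Y'),
    unit_ Y' \oc f = fmap R (fmap L f) \oc unit_ Y;
  counit_nat : forall (X X' : C) (f : hom X X'),
    f \oc counit X = counit X' \oc fmap L (fmap R f);
  triangleL : forall Y : D, counit (L Y) \oc fmap L (unit_ Y) = idm (L Y);
  triangleR : forall X : C, fmap R (counit X) \oc unit_ (R X) = idm (R X) }.

Record cokernel (C : category) (X Y : C) (f : hom X Y) := Cokernel {
  coker_obj : C;
  coker_map : hom Y coker_obj;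
  coker_comp : coker_map \oc f = zerom X coker_obj;
  coker_desc : forall (Z : C) (g : hom Y Z),
    g \oc f = zerom X Z -> hom coker_obj Z;
  coker_descK : forall (Z : C) (g : hom Y Z) (g0 : g \oc f = zerom X Z),
    coker_desc g0 \oc coker_map = g;
  coker_uniq : forall (Z : C) (h h' : hom coker_obj Z),
    h \oc coker_map = h' \oc coker_map -> h = h' }.

Record kernel (C : category) (X Y : C) (f : hom X Y) := Kernel {
  ker_obj : C;
  ker_map : hom ker_obj X;
  ker_comp : f \oc ker_map = zerom ker_obj Y;
  ker_lift : forall (Z : C) (g : hom Z X),
    f \oc g = zerom Z Y -> hom Z ker_obj;
  ker_liftK : forall (Z : C) (g : hom Z X) (g0 : f \oc g = zerom Z Y),
    ker_map \oc ker_lift g0 = g;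
  ker_uniq : forall (Z : C) (h h' : hom Z ker_obj),
    ker_map \oc h = ker_map \oc h' -> h = h' }.

Record seq_colimit (C : category) (D : nat -> C)
    (d : forall n, hom (D n) (D n.+1)) := SeqColimit {
  colim_obj : C;
  colim_in : forall n, hom (D n) colim_obj;
  colim_comp : forall n, colim_in n.+1 \oc d n = colim_in n;
  colim_desc : forall (Z : C) (g : forall n, hom (D n) Z),
    (forall n, g n.+1 \oc d n = g n) -> hom colim_obj Z;
  colim_descK : forall (Z : C) (g : forall n, hom (D n) Z)
      (gd : forall n, g n.+1 \oc d n = g n) n,
    colim_desc gd \oc colim_in n = g n;
  colim_uniq : forall (Z : C) (h h' : hom colim_obj Z),
    (forall n, h \oc colim_in n = h' \oc colim_in n) -> h = h' }.

Record filt_category := FiltCategory {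
  cat_of :> category;
  coker : forall (X Y : cat_of) (f : hom X Y), cokernel f;
  ker : forall (X Y : cat_of) (f : hom X Y), kernel f;
  colim : forall (D : nat -> cat_of) (d : forall n, hom (D n) (D n.+1)),
    seq_colimit d }.

Section Tower.
Context (C : filt_category) (D : category).
Context (L : functor D C) (R : functor C D) (adj : adjunction L R) (F : C).

Fixpoint tower (p : nat) : C :=
  if p is p'.+1 then coker_obj (coker (counit adj (tower p'))) else F.

Fixpoint tower_map (p : nat) : hom F (tower p) :=
  if p is p'.+1 then coker_map (coker (counit adj (tower p'))) \oc tower_map p'
  else idm F.

Definition filt (p : nat) : C := ker_obj (ker (tower_map p.+1)).

Definition filt_map (p : nat) : hom (filt p) F :=
  ker_map (ker (tower_map p.+1)).

Lemma filt_step_subproof p :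
  tower_map p.+2 \oc filt_map p = zerom (filt p) (tower p.+2).
Proof.
change (tower_map p.+2) with
  (coker_map (coker (counit adj (tower p.+1))) \oc tower_map p.+1).
by rewrite -compA ker_comp comp0r.
Qed.

Definition filt_step (p : nat) : hom (filt p) (filt p.+1) :=
  ker_lift (ker (tower_map p.+2)) (filt_step_subproof p).

Lemma filt_stepK p : filt_map p.+1 \oc filt_step p = filt_map p.
Proof. exact: ker_liftK. Qed.

(* the object F_f together with its canonical morphism to F *)
Definition filt_colim : C := colim_obj (colim filt_step).

Definition filt_colim_map : hom filt_colim F :=
  colim_desc (colim filt_step) filt_stepK.

End Tower.

(* A K-algebra is a ring with a ring morphism from K to its centre. MathComp's *)
(* algType would exclude the zero ring.                                        *)
Record kalgebra (K : comPzRingType) := KAlgebra {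
  alg_ring :> pzRingType;
  alg_map : {rmorphism K -> alg_ring};
  alg_central : forall k (a : alg_ring), alg_map k * a = a * alg_map k }.

Definition ground (K : comPzRingType) : kalgebra K :=
  @KAlgebra K K idfun (fun k a => mulrC k a).

Record bimod (K : comPzRingType) (A : kalgebra K) := Bimod {
  bm_sort :> lmodType A;
  ract : bm_sort -> A -> bm_sort;
  ractDl : forall x y a, ract (x + y) a = ract x a + ract y a;
  ractDr : forall x a b, ract x (a + b) = ract x a + ract x b;
  ractA : forall x a b, ract x (a * b) = ract (ract x a) b;
  ract1 : forall x, ract x 1 = x;
  ract_scale : forall a x b, ract (a *: x) b = a *: ract x b;
  bm_symm : forall k x, alg_map A k *: x = ract x (alg_map A k) }.

Record bimod_hom (K : comPzRingType) (A : kalgebra K) (X Y : bimod A) :=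
  BimodHom {
  bm_fun :> X -> Y;
  bm_linear : forall a x y, bm_fun (a *: x + y) = a *: bm_fun x + bm_fun y;
  bm_ract : forall x a, bm_fun (ract x a) = ract (bm_fun x) a }.

Section BimodCategory.
Context (K : comPzRingType) (A : kalgebra K).
Implicit Types X Y Z : bimod A.

HB.instance Definition _ X Y (f : bimod_hom X Y) :=
  GRing.isLinear.Build A X Y *:%R (bm_fun f) (@bm_linear _ _ _ _ f).

Lemma bm_fun0 X Y (f : bimod_hom X Y) : f 0 = 0. Proof. exact: raddf0. Qed.
Lemma bm_funD X Y (f : bimod_hom X Y) x y : f (x + y) = f x + f y.
Proof. exact: raddfD. Qed.
Lemma bm_funB X Y (f : bimod_hom X Y) x y : f (x - y) = f x - f y.
Proof. exact: raddfB. Qed.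
Lemma bm_funZ X Y (f : bimod_hom X Y) a x : f (a *: x) = a *: f x.
Proof. exact: linearZ. Qed.

Lemma bimod_hom_ext X Y (f g : bimod_hom X Y) : bm_fun f =1 bm_fun g -> f = g.
Proof.
case: f g => [f f1 f2] [g g1 g2] /= /funext fg; case: _ / fg in g1 g2 *.
by congr BimodHom; exact: Prop_irrelevance.
Qed.

Program Definition bimod_id X : bimod_hom X X := @BimodHom _ _ X X id _ _.

Program Definition bimod_comp X Y Z (g : bimod_hom Y Z) (f : bimod_hom X Y) :=
  @BimodHom _ _ X Z (fun x => g (f x)) _ _.
Next Obligation. by move=> * /=; rewrite !bm_linear. Qed.
Next Obligation. by move=> * /=; rewrite !bm_ract. Qed.

Lemma ract0 X (a : A) : ract (0 : X) a = 0.
Proof. by apply: (@addIr _ (ract 0 a)); rewrite -ractDl !add0r. Qed.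

Lemma ractN X (x : X) (a : A) : ract (- x) a = - ract x a.
Proof. by apply: (@addIr _ (ract x a)); rewrite -ractDl !addNr ract0. Qed.

Program Definition bimod_zero X Y :=
  @BimodHom _ _ X Y (fun=> 0) _ _.
Next Obligation. by move=> *; rewrite scaler0 addr0. Qed.
Next Obligation. by move=> *; rewrite ract0. Qed.

Definition bimod_category : category.
Proof.
refine (@Category (bimod A) (@bimod_hom K A) bimod_id bimod_comp bimod_zero
  _ _ _ _ _) => *; apply: bimod_hom_ext => //= x.
exact: linear0.
Defined.

End BimodCategory.

Record subbimod (K : comPzRingType) (A : kalgebra K) (F : bimod A) := SubBimod {
  sb_set :> F -> Prop;
  sb0 : sb_set 0;
  sbD : forall x y, sb_set x -> sb_set y -> sb_set (x + y);
  sbZ : forall a x, sb_set x -> sb_set (a *: x);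
  sbR : forall a x, sb_set x -> sb_set (ract x a) }.

Section SubQuotient.
Context (K : comPzRingType) (A : kalgebra K) (F : bimod A) (U : subbimod F).

Definition sb_mem : {pred F} := [pred x | `[< U x >]].

Lemma sb_memP x : reflect (U x) (x \in sb_mem).
Proof. exact: asboolP. Qed.

Lemma sb_mem_closed : GRing.subsemimod_closed sb_mem.
Proof.
split; first split.
- by apply/sb_memP; exact: sb0.
- by move=> x y /sb_memP Ux /sb_memP Uy; apply/sb_memP; exact: sbD.
- by move=> a x /sb_memP Ux; apply/sb_memP; exact: sbZ.
Qed.

HB.instance Definition _ := GRing.isSubSemiModClosed.Build A F sb_mem sb_mem_closed.

Lemma sb_mem_oppr : GRing.oppr_closed sb_mem.
Proof. by move=> x; rewrite -scaleN1r => /sb_memP Ux; apply/sb_memP; exact: sbZ. Qed.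

HB.instance Definition _ := GRing.isOppClosed.Build F sb_mem sb_mem_oppr.

Record sb_sort := SbSort { sb_val : F; sb_valP : sb_val \in sb_mem }.

HB.instance Definition _ := [isSub for sb_val].
HB.instance Definition _ := [Choice of sb_sort by <:].
HB.instance Definition _ := [SubChoice_isSubLmodule of sb_sort by <:].

Lemma sb_val_inj : injective sb_val. Proof. exact: val_inj. Qed.

Lemma sb_ract_subproof (x : sb_sort) (a : A) : ract (sb_val x) a \in sb_mem.
Proof. by apply/sb_memP/sbR/sb_memP/sb_valP. Qed.

Program Definition sub_bimod : bimod A :=
  @Bimod K A sb_sort (fun x a => SbSort (sb_ract_subproof x a)) _ _ _ _ _ _.
Next Obligation. by move=> *; apply: sb_val_inj; rewrite /= ractDl. Qed.
Next Obligation. by move=> *; apply: sb_val_inj; rewrite /= ractDr. Qed.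
Next Obligation. by move=> *; apply: sb_val_inj; rewrite /= ractA. Qed.
Next Obligation. by move=> *; apply: sb_val_inj; rewrite /= ract1. Qed.
Next Obligation. by move=> *; apply: sb_val_inj; rewrite /= ract_scale. Qed.
Next Obligation. by move=> *; apply: sb_val_inj; rewrite /= bm_symm. Qed.

Program Definition sub_incl : bimod_hom sub_bimod F :=
  @BimodHom _ _ sub_bimod F sb_val _ _.

Definition quot_sort := Quotient.quot sb_mem.
HB.instance Definition _ := GRing.Zmodule.on quot_sort.

Definition quot_pi (x : F) : quot_sort := \pi_(Quotient.quot sb_mem) x.

Lemma quot_piP x y : quot_pi x = quot_pi y <-> U (x - y).
Proof.
rewrite /quot_pi; split=> [/eqP|Uxy]; last apply/eqP.
  by rewrite -Quotient.idealrBE => /sb_memP.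
by rewrite -Quotient.idealrBE; apply/sb_memP.
Qed.

Lemma quot_piD x y : quot_pi (x + y) = quot_pi x + quot_pi y.
Proof. exact: (raddfD (\pi_(Quotient.quot sb_mem))). Qed.

Lemma quot_pi0 : quot_pi 0 = 0.
Proof. exact: (raddf0 (\pi_(Quotient.quot sb_mem))). Qed.

Lemma quot_reprK (q : quot_sort) : quot_pi (repr q) = q.
Proof. exact: reprK. Qed.

Definition quot_scale (a : A) (q : quot_sort) : quot_sort := quot_pi (a *: repr q).
Definition quot_ract (q : quot_sort) (a : A) : quot_sort := quot_pi (ract (repr q) a).

Lemma quot_scale_pi a x : quot_scale a (quot_pi x) = quot_pi (a *: x).
Proof. by apply/quot_piP; rewrite -scalerBr; apply/sbZ/quot_piP/quot_reprK. Qed.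

Lemma quot_ract_pi x a : quot_ract (quot_pi x) a = quot_pi (ract x a).
Proof.
by apply/quot_piP; rewrite -ractN -ractDl; apply/sbR/quot_piP/quot_reprK.
Qed.

Lemma quot_ind (P : quot_sort -> Prop) : (forall x, P (quot_pi x)) -> forall q, P q.
Proof. by move=> Ppi q; rewrite -(quot_reprK q). Qed.

Fact quot_scaleA a b q : quot_scale a (quot_scale b q) = quot_scale (a * b) q.
Proof. by elim/quot_ind: q => x; rewrite !quot_scale_pi scalerA. Qed.
Fact quot_scale1 : left_id 1 quot_scale.
Proof. by elim/quot_ind => x; rewrite quot_scale_pi scale1r. Qed.
Fact quot_scaleDr : right_distributive quot_scale +%R.
Proof.
move=> a; elim/quot_ind=> x; elim/quot_ind=> y.
by rewrite -quot_piD !quot_scale_pi scalerDr quot_piD.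
Qed.
Fact quot_scaleDl q : {morph quot_scale^~ q : a b / a + b}.
Proof.
by move=> a b; elim/quot_ind: q => x; rewrite !quot_scale_pi scalerDl quot_piD.
Qed.

HB.instance Definition _ := GRing.Zmodule_isLmodule.Build A quot_sort
  quot_scaleA quot_scale1 quot_scaleDr quot_scaleDl.

Lemma quot_piZ a x : quot_pi (a *: x) = a *: quot_pi x.
Proof. by rewrite -quot_scale_pi. Qed.

Program Definition quot_bimod : bimod A :=
  @Bimod K A quot_sort quot_ract _ _ _ _ _ _.
Next Obligation.
elim/quot_ind=> x; elim/quot_ind=> y a.
by rewrite -quot_piD !quot_ract_pi ractDl quot_piD.
Qed.
Next Obligation. by elim/quot_ind=> x a b; rewrite !quot_ract_pi ractDr quot_piD. Qed.
Next Obligation. by elim/quot_ind=> x a b; rewrite !quot_ract_pi ractA. Qed.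
Next Obligation. by elim/quot_ind=> x; rewrite quot_ract_pi ract1. Qed.
Next Obligation.
move=> a; elim/quot_ind=> x b.
by rewrite -quot_piZ !quot_ract_pi ract_scale quot_piZ.
Qed.
Next Obligation.
by move=> k; elim/quot_ind=> x; rewrite -quot_piZ quot_ract_pi bm_symm.
Qed.

Program Definition quot_proj : bimod_hom F quot_bimod :=
  @BimodHom _ _ F quot_bimod quot_pi _ _.
Next Obligation. by move=> *; rewrite quot_piD quot_piZ. Qed.
Next Obligation. by move=> *; rewrite /= quot_ract_pi. Qed.

End SubQuotient.

Section KernelCokernel.
Context (K : comPzRingType) (A : kalgebra K) (X Y : bimod A) (f : bimod_hom X Y).

Program Definition kernel_sub : subbimod X := @SubBimod _ _ X [set x | f x = 0] _ _ _ _.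
Next Obligation. exact: bm_fun0. Qed.
Next Obligation. by move=> x y /= fx fy; rewrite bm_funD fx fy addr0. Qed.
Next Obligation. by move=> a x /= fx; rewrite bm_funZ fx scaler0. Qed.
Next Obligation. by move=> a x /= fx; rewrite bm_ract fx ract0. Qed.

Program Definition image_sub : subbimod Y := @SubBimod _ _ Y (range f) _ _ _ _.
Next Obligation. by exists 0 => //; rewrite bm_fun0. Qed.
Next Obligation.
by move=> _ _ [x _ <-] [y _ <-]; exists (x + y) => //; rewrite bm_funD.
Qed.
Next Obligation. by move=> a _ [x _ <-]; exists (a *: x) => //; rewrite bm_funZ. Qed.
Next Obligation. by move=> a _ [x _ <-]; exists (ract x a) => //; rewrite bm_ract. Qed.

Section Lift.
Context (Z : bimod A) (g : bimod_hom Z X).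
Hypothesis fg0 : bimod_comp f g = bimod_zero Z Y.

Lemma ker_lift_subproof z : g z \in sb_mem kernel_sub.
Proof. by apply/sb_memP => /=; exact: (congr1 (fun h : bimod_hom Z Y => h z) fg0). Qed.

Program Definition bimod_ker_lift : bimod_hom Z (sub_bimod kernel_sub) :=
  @BimodHom _ _ Z (sub_bimod kernel_sub) (fun z => SbSort (ker_lift_subproof z)) _ _.
Next Obligation. by move=> *; apply: sb_val_inj; rewrite /= bm_linear. Qed.
Next Obligation. by move=> *; apply: sb_val_inj; rewrite /= bm_ract. Qed.
End Lift.

Section Desc.
Context (Z : bimod A) (g : bimod_hom Y Z).
Hypothesis gf0 : bimod_comp g f = bimod_zero X Z.

Definition coker_desc_fun (q : quot_bimod image_sub) : Z := g (repr q).

Lemma coker_desc_pi y : coker_desc_fun (quot_pi image_sub y) = g y.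
Proof.
have /quot_piP[x _ E] := quot_reprK (quot_pi image_sub y).
apply/eqP; rewrite -subr_eq0 -bm_funB -E; apply/eqP.
exact: (congr1 (fun h : bimod_hom X Z => h x) gf0).
Qed.

Program Definition bimod_coker_desc : bimod_hom (quot_bimod image_sub) Z :=
  @BimodHom _ _ (quot_bimod image_sub) Z coker_desc_fun _ _.
Next Obligation.
move=> a; elim/quot_ind=> x; elim/quot_ind=> y.
by rewrite -quot_piZ -quot_piD !coker_desc_pi bm_linear.
Qed.
Next Obligation.
by elim/quot_ind=> x a; rewrite [ract _ _]quot_ract_pi !coker_desc_pi bm_ract.
Qed.
End Desc.

Definition bimod_ker : @kernel (bimod_category A) X Y f.
Proof.
refine (@Kernel (bimod_category A) X Y f (sub_bimod kernel_sub)
  (sub_incl kernel_sub) _ bimod_ker_lift _ _).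
- by apply: bimod_hom_ext => x; exact: (elimT (sb_memP _ _) (sb_valP x)).
- by move=> Z g fg0; exact: bimod_hom_ext.
- move=> Z h h' E; apply: bimod_hom_ext => z; apply: sb_val_inj.
  exact: (congr1 (fun k : bimod_hom Z X => k z) E).
Defined.

Definition bimod_coker : @cokernel (bimod_category A) X Y f.
Proof.
refine (@Cokernel (bimod_category A) X Y f (quot_bimod image_sub)
  (quot_proj image_sub) _ bimod_coker_desc _ _).
- apply: bimod_hom_ext => x /=; change (quot_pi image_sub (f x) = 0).
  by rewrite -quot_pi0; apply/quot_piP; rewrite subr0; exists x.
- by move=> Z g gf0; apply: bimod_hom_ext => y /=; exact: coker_desc_pi.
- move=> Z h h' E; apply: bimod_hom_ext; elim/quot_ind=> y.
  exact: (congr1 (fun k : bimod_hom Y Z => k y) E).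
Defined.

End KernelCokernel.

(* The abelian group freely generated by S subject to a class P of maps into   *)
(* abelian groups: formal sums of signed elements of S, where two sums are     *)
(* identified when no map in P distinguishes them. When P is closed under      *)
(* joint separation, as it is for classes defined by linear equations, S ->    *)
(* pres P is the universal member of P.                                        *)
Section Presented.
Context (S : Type) (P : forall W : zmodType, (S -> W) -> Prop).

Definition word := seq (bool * S).
HB.instance Definition _ := gen_eqMixin word.
HB.instance Definition _ := gen_choiceMixin word.

Definition weval (W : zmodType) (g : S -> W) (w : word) : W :=
  \sum_(s <- w) (if s.1 then - g s.2 else g s.2).

Definition word_eqv (w1 w2 : word) : bool :=
  `[< forall (W : zmodType) (g : S -> W), P g -> weval g w1 = weval g w2 >].

Lemma word_eqv_refl : reflexive word_eqv.
Proof. by move=> w; apply/asboolP. Qed.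
Lemma word_eqv_sym : symmetric word_eqv.
Proof.
by move=> w1 w2; apply/asboolP/asboolP => E W g Pg; rewrite (E W g Pg).
Qed.
Lemma word_eqv_trans : transitive word_eqv.
Proof.
move=> w2 w1 w3 /asboolP E /asboolP E'; apply/asboolP => W g Pg.
by rewrite (E W g Pg) E'.
Qed.

Canonical word_equiv :=
  EquivRel word_eqv word_eqv_refl word_eqv_sym word_eqv_trans.

Definition pres := {eq_quot word_eqv}.
HB.instance Definition _ := Choice.on pres.

Definition pres_pi (w : word) : pres := \pi_{eq_quot word_eqv} w.

Lemma pres_piP w1 w2 : pres_pi w1 = pres_pi w2 <->
  forall (W : zmodType) (g : S -> W), P g -> weval g w1 = weval g w2.
Proof.
split=> [/eqP|E]; first by rewrite /pres_pi piE => /asboolP.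
by apply/eqP; rewrite /pres_pi piE; apply/asboolP.
Qed.

Lemma pres_reprK (q : pres) : pres_pi (repr q) = q.
Proof. exact: reprK. Qed.

Lemma pres_ind (Q : pres -> Prop) : (forall w, Q (pres_pi w)) -> forall q, Q q.
Proof. by move=> Qpi q; rewrite -(pres_reprK q). Qed.

Definition wneg (w : word) : word := [seq (~~ s.1, s.2) | s <- w].

Lemma weval_nil (W : zmodType) (g : S -> W) : weval g [::] = 0.
Proof. exact: big_nil. Qed.
Lemma weval_cat (W : zmodType) (g : S -> W) w1 w2 :
  weval g (w1 ++ w2) = weval g w1 + weval g w2.
Proof. exact: big_cat. Qed.
Lemma weval_neg (W : zmodType) (g : S -> W) w : weval g (wneg w) = - weval g w.
Proof.
rewrite /weval big_map -sumrN; apply: eq_bigr => -[b s] _ /=.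
by case: b; rewrite //= opprK.
Qed.

Definition pres_add (q1 q2 : pres) : pres := pres_pi (repr q1 ++ repr q2).
Definition pres_opp (q : pres) : pres := pres_pi (wneg (repr q)).

Lemma pres_addE w1 w2 : pres_add (pres_pi w1) (pres_pi w2) = pres_pi (w1 ++ w2).
Proof.
apply/pres_piP => W g Pg; rewrite !weval_cat.
by congr (_ + _); apply: (pres_piP _ _).1 Pg; exact: pres_reprK.
Qed.

Lemma pres_oppE w : pres_opp (pres_pi w) = pres_pi (wneg w).
Proof.
apply/pres_piP => W g Pg; rewrite !weval_neg; congr (- _).
by apply: (pres_piP _ _).1 Pg; exact: pres_reprK.
Qed.

Fact pres_addA : associative pres_add.
Proof.
elim/pres_ind=> w1; elim/pres_ind=> w2; elim/pres_ind=> w3.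
by rewrite !pres_addE catA.
Qed.
Fact pres_addC : commutative pres_add.
Proof.
elim/pres_ind=> w1; elim/pres_ind=> w2; rewrite !pres_addE.
by apply/pres_piP => W g _; rewrite !weval_cat addrC.
Qed.
Fact pres_add0 : left_id (pres_pi [::]) pres_add.
Proof. by elim/pres_ind=> w; rewrite pres_addE. Qed.
Fact pres_addN : left_inverse (pres_pi [::]) pres_opp pres_add.
Proof.
elim/pres_ind=> w; rewrite pres_oppE pres_addE.
by apply/pres_piP => W g _; rewrite weval_cat weval_neg addNr weval_nil.
Qed.

HB.instance Definition _ :=
  GRing.isZmodule.Build pres pres_addA pres_addC pres_add0 pres_addN.

Lemma pres_piD w1 w2 : pres_pi (w1 ++ w2) = pres_pi w1 + pres_pi w2.
Proof. by rewrite -pres_addE. Qed.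

Definition pgen (s : S) : pres := pres_pi [:: (false, s)].

Lemma weval_pgen w : weval pgen w = pres_pi w.
Proof.
elim: w => [|[b s] w IHw]; first by rewrite weval_nil.
rewrite -cat1s weval_cat pres_piD IHw; congr (_ + _).
by rewrite /weval big_seq1 /=; case: b => //; exact: (pres_oppE [:: (false, s)]).
Qed.

(* the extension of a map in P; meaningful only when P g *)
Definition plift (W : zmodType) (g : S -> W) (q : pres) : W := weval g (repr q).

Section Lift.
Context (W : zmodType) (g : S -> W).
Hypothesis Pg : P g.

Lemma plift_pi w : plift g (pres_pi w) = weval g w.
Proof. by apply: (pres_piP _ _).1 Pg; exact: pres_reprK. Qed.

Lemma plift_gen s : plift g (pgen s) = g s.
Proof. by rewrite plift_pi /weval big_seq1. Qed.

Lemma pliftD q1 q2 : plift g (q1 + q2) = plift g q1 + plift g q2.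
Proof.
elim/pres_ind: q1 => w1; elim/pres_ind: q2 => w2.
by rewrite -pres_piD !plift_pi weval_cat.
Qed.
End Lift.

Lemma pres_ext (W : zmodType) (h h' : pres -> W) :
  {morph h : x y / x + y} -> {morph h' : x y / x + y} ->
  (forall s, h (pgen s) = h' (pgen s)) -> h =1 h'.
Proof.
move=> hD h'D hh'.
have hz (k : pres -> W) : {morph k : x y / x + y} -> k 0 = 0.
  by move=> kD; apply: (@addIr _ (k 0)); rewrite -kD !add0r.
have hN (k : pres -> W) : {morph k : x y / x + y} -> {morph k : x / - x}.
  by move=> kD x; apply: (@addIr _ (k x)); rewrite -kD !addNr hz.
elim/pres_ind=> w; rewrite -weval_pgen; elim: w => [|[b s] w IHw].
  by rewrite weval_nil !hz.
rewrite -cat1s weval_cat hD h'D IHw; congr (_ + _).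
by rewrite /weval big_seq1; case: b => //=; rewrite !hN // hh'.
Qed.

End Presented.

Section Tensor.
Context (K : comPzRingType) (A : kalgebra K) (V : bimod (ground K)).

Definition balanced (W : zmodType) (g : A * V -> W) : Prop :=
  [/\ forall a b v, g (a + b, v) = g (a, v) + g (b, v),
      forall a v w, g (a, v + w) = g (a, v) + g (a, w)
    & forall a (k : K) v, g (a * alg_map A k, v) = g (a, k *: v)].

Definition tensor := pres balanced.
HB.instance Definition _ := GRing.Zmodule.on tensor.

Definition tens (a : A) (v : V) : tensor := pgen balanced (a, v).

Lemma tens_balanced : balanced (fun s => tens s.1 s.2).
Proof.
have wE (W : zmodType) (g : A * V -> W) s : weval g [:: (false, s)] = g s.
  by rewrite /weval big_seq1.
split=> /= [a b v|a v w|a k v]; rewrite /tens /pgen.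
- by rewrite -pres_piD; apply/pres_piP => W g [gl gr gk]; rewrite weval_cat !wE.
- by rewrite -pres_piD; apply/pres_piP => W g [gl gr gk]; rewrite weval_cat !wE.
- by apply/pres_piP => W g [gl gr gk]; rewrite !wE.
Qed.

Lemma tensDl a b v : tens (a + b) v = tens a v + tens b v.
Proof. by have [gl _ _] := tens_balanced; exact: gl. Qed.
Lemma tensDr a v w : tens a (v + w) = tens a v + tens a w.
Proof. by have [_ gr _] := tens_balanced; exact: gr. Qed.
Lemma tens_mid a (k : K) v : tens (a * alg_map A k) v = tens a (k *: v).
Proof. by have [_ _ gk] := tens_balanced; exact: gk. Qed.

Lemma tensor_universal (W : zmodType) (g : A * V -> W) : balanced g ->
  exists! h : tensor -> W,
    {morph h : x y / x + y} /\ forall a v, h (tens a v) = g (a, v).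
Proof.
move=> Pg; exists (plift g); split=> [|h [hD hg]].
  by split=> [x y|a v]; [exact: pliftD|exact: plift_gen].
apply/funext; apply: pres_ext => //; first by move=> x y; exact: pliftD.
by case=> a v; rewrite plift_gen // -hg.
Qed.

Lemma tensor_ext (W : zmodType) (h h' : tensor -> W) :
  {morph h : x y / x + y} -> {morph h' : x y / x + y} ->
  (forall a v, h (tens a v) = h' (tens a v)) -> h =1 h'.
Proof. by move=> hD h'D hh'; apply: pres_ext => // -[a v]; exact: hh'. Qed.

Definition tensor_scale (a : A) : tensor -> tensor :=
  plift (fun s => tens (a * s.1) s.2).
Definition tensor_ract (x : tensor) (c : A) : tensor :=
  plift (fun s => tens (s.1 * c) s.2) x.

Lemma tensor_scale_balanced a : balanced (fun s => tens (a * s.1) s.2).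
Proof.
split=> /= [b c v|b v w|b k v]; first by rewrite mulrDr tensDl.
  by rewrite tensDr.
by rewrite mulrA tens_mid.
Qed.

Lemma tensor_ract_balanced c : balanced (fun s => tens (s.1 * c) s.2).
Proof.
split=> /= [a b v|b v w|b k v]; first by rewrite mulrDl tensDl.
  by rewrite tensDr.
by rewrite -mulrA alg_central mulrA tens_mid.
Qed.

Lemma tensor_scale_tens a b v : tensor_scale a (tens b v) = tens (a * b) v.
Proof. exact/plift_gen/tensor_scale_balanced. Qed.
Lemma tensor_ract_tens b v c : tensor_ract (tens b v) c = tens (b * c) v.
Proof. exact: (plift_gen (tensor_ract_balanced c) (b, v)). Qed.
Lemma tensor_scaleD a : {morph tensor_scale a : x y / x + y}.
Proof. by move=> x y; apply/pliftD/tensor_scale_balanced. Qed.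
Lemma tensor_ractD c : {morph tensor_ract^~ c : x y / x + y}.
Proof. by move=> x y; exact: (pliftD (tensor_ract_balanced c) x y). Qed.

Fact tensor_scaleA a b x : tensor_scale a (tensor_scale b x) = tensor_scale (a * b) x.
Proof.
move: x; apply: tensor_ext => [x y|x y|c v]; rewrite ?tensor_scaleD //.
by rewrite !tensor_scale_tens mulrA.
Qed.
Fact tensor_scale1 : left_id 1 tensor_scale.
Proof.
apply: tensor_ext => [x y|x y|c v] //; first exact: tensor_scaleD.
by rewrite tensor_scale_tens mul1r.
Qed.
Fact tensor_scaleDl x : {morph tensor_scale^~ x : a b / a + b}.
Proof.
move=> a b; move: x; apply: tensor_ext => [x y|x y|c v].
- exact: tensor_scaleD.
- by rewrite !tensor_scaleD addrACA.
- by rewrite !tensor_scale_tens mulrDl tensDl.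
Qed.

HB.instance Definition _ := GRing.Zmodule_isLmodule.Build A tensor
  tensor_scaleA tensor_scale1 tensor_scaleD tensor_scaleDl.

Lemma tens_scale a b v : a *: tens b v = tens (a * b) v.
Proof. exact: tensor_scale_tens. Qed.

(* a (b (x) v) c = a b c (x) v *)
Program Definition tensor_bimod : bimod A :=
  @Bimod K A tensor tensor_ract _ _ _ _ _ _.
Next Obligation. by move=> x y a; exact: tensor_ractD. Qed.
Next Obligation.
move=> x a b; move: x; apply: tensor_ext => [x y|x y|c v].
- exact: tensor_ractD.
- by rewrite !tensor_ractD addrACA.
- by rewrite !tensor_ract_tens mulrDr tensDl.
Qed.
Next Obligation.
move=> x a b; move: x; apply: tensor_ext => [x y|x y|c v];
  rewrite ?tensor_ractD //.
by rewrite !tensor_ract_tens mulrA.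
Qed.
Next Obligation.
apply: tensor_ext => [x y|x y|c v] //; first exact: tensor_ractD.
by rewrite tensor_ract_tens mulr1.
Qed.
Next Obligation.
move=> a x b; move: x; apply: tensor_ext => [x y|x y|c v].
- by rewrite scalerDr tensor_ractD.
- by rewrite tensor_ractD scalerDr.
- by rewrite tensor_ract_tens !tens_scale tensor_ract_tens mulrA.
Qed.
Next Obligation.
move=> k; apply: tensor_ext => [x y|x y|c v].
- exact: scalerDr.
- exact: tensor_ractD.
- by rewrite tensor_ract_tens tens_scale alg_central.
Qed.

End Tensor.

Section TensorFunctor.
Context (K : comPzRingType) (A : kalgebra K).

Section Map.
Context (V V' : bimod (ground K)) (f : bimod_hom V V').

Definition tensor_map_fun : tensor A V -> tensor A V' :=
  plift (fun s => tens s.1 (f s.2)).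

Lemma tensor_map_balanced : balanced (fun s : A * V => tens s.1 (f s.2)).
Proof.
split=> /= [a b v|a v w|a k v]; first by rewrite tensDl.
  by rewrite bm_funD tensDr.
by rewrite tens_mid (bm_funZ f).
Qed.

Lemma tensor_map_tens a v : tensor_map_fun (tens a v) = tens a (f v).
Proof. exact: (plift_gen tensor_map_balanced (a, v)). Qed.

Lemma tensor_mapD : {morph tensor_map_fun : x y / x + y}.
Proof. by move=> x y; exact: (pliftD tensor_map_balanced x y). Qed.

Program Definition tensor_map : bimod_hom (tensor_bimod A V) (tensor_bimod A V') :=
  @BimodHom _ _ (tensor_bimod A V) (tensor_bimod A V') tensor_map_fun _ _.
Next Obligation.
move=> a x y; rewrite tensor_mapD; congr (_ + _).
move: x; apply: tensor_ext => [x y'|x y'|c v].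
- by rewrite scalerDr tensor_mapD.
- by rewrite tensor_mapD scalerDr.
- by rewrite tens_scale !tensor_map_tens tens_scale.
Qed.
Next Obligation.
move=> x a; move: x; apply: tensor_ext => [x y'|x y'|c v].
- by rewrite ractDl tensor_mapD.
- by rewrite tensor_mapD ractDl.
- by rewrite [ract _ _]tensor_ract_tens !tensor_map_tens [RHS]tensor_ract_tens.
Qed.
End Map.

Definition tensor_functor : functor (bimod_category (ground K)) (bimod_category A).
Proof.
refine (@Functor (bimod_category (ground K)) (bimod_category A)
  (tensor_bimod A) tensor_map _ _).
- move=> V; apply: bimod_hom_ext; apply: tensor_ext => [x y|x y|a v] //.
    exact: tensor_mapD.
  exact: tensor_map_tens.
- move=> V V' V'' g f; apply: bimod_hom_ext.
  apply: tensor_ext => [x y|x y|a v]; first exact: tensor_mapD.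
    by rewrite /= !tensor_mapD.
  by rewrite /= !tensor_map_tens.
Defined.

End TensorFunctor.

Section BimodColimit.
Context (K : comPzRingType) (A : kalgebra K).
Context (D : nat -> bimod A) (d : forall n, bimod_hom (D n) (D n.+1)).

Definition cocone (W : zmodType) (g : {n & D n} -> W) : Prop :=
  (forall n (x y : D n),
     g (Tagged D (x + y)) = g (Tagged D x) + g (Tagged D y)) /\
  (forall n (x : D n), g (Tagged D (d n x)) = g (Tagged D x)).

Definition bcolim := pres cocone.
HB.instance Definition _ := GRing.Zmodule.on bcolim.

Definition bcolim_in n (x : D n) : bcolim := pgen cocone (Tagged D x).

Lemma bcolim_inD n (x y : D n) : bcolim_in (x + y) = bcolim_in x + bcolim_in y.
Proof.
rewrite /bcolim_in /pgen -pres_piD; apply/pres_piP => W g [gD _].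
by rewrite weval_cat /weval !big_seq1 gD.
Qed.

Lemma bcolim_in_step n (x : D n) : bcolim_in (d n x) = bcolim_in x.
Proof.
by apply/pres_piP => W g [_ gd]; rewrite /weval !big_seq1 gd.
Qed.

Lemma bcolim_ext (W : zmodType) (h h' : bcolim -> W) :
  {morph h : x y / x + y} -> {morph h' : x y / x + y} ->
  (forall n (x : D n), h (bcolim_in x) = h' (bcolim_in x)) -> h =1 h'.
Proof. by move=> hD h'D hh'; apply: pres_ext => // -[n x]; exact: hh'. Qed.

Definition bcolim_scale (a : A) : bcolim -> bcolim :=
  plift (fun s : {n & D n} => bcolim_in (a *: tagged s)).
Definition bcolim_ract (q : bcolim) (a : A) : bcolim :=
  plift (fun s : {n & D n} => bcolim_in (ract (tagged s) a)) q.

Lemma bcolim_scale_cocone a :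
  cocone (fun s : {n & D n} => bcolim_in (a *: tagged s)).
Proof.
split=> n x /=; first by move=> y; rewrite scalerDr bcolim_inD.
by rewrite -bm_funZ bcolim_in_step.
Qed.

Lemma bcolim_ract_cocone a :
  cocone (fun s : {n & D n} => bcolim_in (ract (tagged s) a)).
Proof.
split=> n x /=; first by move=> y; rewrite ractDl bcolim_inD.
by rewrite -bm_ract bcolim_in_step.
Qed.

Lemma bcolim_scale_in a n (x : D n) :
  bcolim_scale a (bcolim_in x) = bcolim_in (a *: x).
Proof. exact: (plift_gen (bcolim_scale_cocone a) (Tagged D x)). Qed.
Lemma bcolim_ract_in a n (x : D n) :
  bcolim_ract (bcolim_in x) a = bcolim_in (ract x a).
Proof. exact: (plift_gen (bcolim_ract_cocone a) (Tagged D x)). Qed.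
Lemma bcolim_scaleD a : {morph bcolim_scale a : x y / x + y}.
Proof. by move=> x y; apply: pliftD; exact: bcolim_scale_cocone. Qed.
Lemma bcolim_ractD a : {morph bcolim_ract^~ a : x y / x + y}.
Proof. by move=> x y; exact: (pliftD (bcolim_ract_cocone a) x y). Qed.

Fact bcolim_scaleA a b x : bcolim_scale a (bcolim_scale b x) = bcolim_scale (a * b) x.
Proof.
move: x; apply: bcolim_ext => [x y|x y|n x]; rewrite ?bcolim_scaleD //.
by rewrite !bcolim_scale_in scalerA.
Qed.
Fact bcolim_scale1 : left_id 1 bcolim_scale.
Proof.
apply: bcolim_ext => [x y|x y|n x] //; first exact: bcolim_scaleD.
by rewrite bcolim_scale_in scale1r.
Qed.
Fact bcolim_scaleDl x : {morph bcolim_scale^~ x : a b / a + b}.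
Proof.
move=> a b; move: x; apply: bcolim_ext => [x y|x y|n x].
- exact: bcolim_scaleD.
- by rewrite !bcolim_scaleD addrACA.
- by rewrite !bcolim_scale_in scalerDl bcolim_inD.
Qed.

HB.instance Definition _ := GRing.Zmodule_isLmodule.Build A bcolim
  bcolim_scaleA bcolim_scale1 bcolim_scaleD bcolim_scaleDl.

Lemma bcolim_inZ a n (x : D n) : bcolim_in (a *: x) = a *: bcolim_in x.
Proof. by rewrite -bcolim_scale_in. Qed.

Program Definition bcolim_bimod : bimod A :=
  @Bimod K A bcolim bcolim_ract _ _ _ _ _ _.
Next Obligation. by move=> x y a; exact: bcolim_ractD. Qed.
Next Obligation.
move=> x a b; move: x; apply: bcolim_ext => [x y|x y|n x].
- exact: bcolim_ractD.
- by rewrite !bcolim_ractD addrACA.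
- by rewrite !bcolim_ract_in ractDr bcolim_inD.
Qed.
Next Obligation.
move=> x a b; move: x; apply: bcolim_ext => [x y|x y|n x];
  rewrite ?bcolim_ractD //.
by rewrite !bcolim_ract_in ractA.
Qed.
Next Obligation.
apply: bcolim_ext => [x y|x y|n x] //; first exact: bcolim_ractD.
by rewrite bcolim_ract_in ract1.
Qed.
Next Obligation.
move=> a x b; move: x; apply: bcolim_ext => [x y|x y|n x].
- by rewrite scalerDr bcolim_ractD.
- by rewrite bcolim_ractD scalerDr.
- by rewrite bcolim_ract_in -!bcolim_inZ bcolim_ract_in ract_scale.
Qed.
Next Obligation.
move=> k; apply: bcolim_ext => [x y|x y|n x].
- exact: scalerDr.
- exact: bcolim_ractD.
- by rewrite bcolim_ract_in -bcolim_inZ bm_symm.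
Qed.

Program Definition bcolim_in_hom n : bimod_hom (D n) bcolim_bimod :=
  @BimodHom _ _ (D n) bcolim_bimod (@bcolim_in n) _ _.
Next Obligation. by move=> n a x y; rewrite bcolim_inD bcolim_inZ. Qed.
Next Obligation. by move=> n x a; rewrite [RHS]bcolim_ract_in. Qed.

Section Desc.
Context (Z : bimod A) (g : forall n, bimod_hom (D n) Z).
Hypothesis gd : forall n, bimod_comp (g n.+1) (d n) = g n.

Definition bcolim_desc_fun : bcolim -> Z :=
  plift (fun s : {n & D n} => g (tag s) (tagged s)).

Lemma bcolim_desc_cocone : cocone (fun s : {n & D n} => g (tag s) (tagged s)).
Proof.
split=> n x /=; first by move=> y; rewrite bm_funD.
by rewrite -[in RHS]gd.
Qed.

Lemma bcolim_desc_in n (x : D n) : bcolim_desc_fun (bcolim_in x) = g n x.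
Proof. exact: (plift_gen bcolim_desc_cocone (Tagged D x)). Qed.
Lemma bcolim_descD : {morph bcolim_desc_fun : x y / x + y}.
Proof. by move=> x y; exact: (pliftD bcolim_desc_cocone x y). Qed.

Program Definition bcolim_desc : bimod_hom bcolim_bimod Z :=
  @BimodHom _ _ bcolim_bimod Z bcolim_desc_fun _ _.
Next Obligation.
move=> a x y; rewrite bcolim_descD; congr (_ + _).
move: x; apply: bcolim_ext => [x y'|x y'|n x].
- by rewrite scalerDr bcolim_descD.
- by rewrite bcolim_descD scalerDr.
- by rewrite -bcolim_inZ !bcolim_desc_in bm_funZ.
Qed.
Next Obligation.
move=> x a; move: x; apply: bcolim_ext => [x y'|x y'|n x].
- by rewrite ractDl bcolim_descD.
- by rewrite bcolim_descD ractDl.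
- by rewrite [ract _ _]bcolim_ract_in !bcolim_desc_in bm_ract.
Qed.
End Desc.

Definition bimod_colim : @seq_colimit (bimod_category A) D d.
Proof.
refine (@SeqColimit (bimod_category A) D d bcolim_bimod bcolim_in_hom
  _ bcolim_desc _ _).
- by move=> n; apply: bimod_hom_ext => x; exact: bcolim_in_step.
- by move=> Z g gd n; apply: bimod_hom_ext => x; exact: bcolim_desc_in.
- move=> Z h h' E; apply: bimod_hom_ext; apply: bcolim_ext => [x y|x y|n x].
  + exact: bm_funD.
  + exact: bm_funD.
  + exact: (congr1 (fun k : bimod_hom (D n) Z => k x) (E n)).
Defined.

End BimodColimit.

(* A-bimodules symmetric over K; for A = K these are symmetric K-bimodules. *)
Definition Qcoh (K : comPzRingType) (A : kalgebra K) : filt_category :=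
  @FiltCategory (bimod_category A) (@bimod_coker K A) (@bimod_ker K A)
    (@bimod_colim K A).

(* f^* for the morphism f : X -> Y, with Qcoh(X) = Qcoh A, Qcoh(Y) = Qcoh K *)
Definition pullback (K : comPzRingType) (A : kalgebra K) :
  functor (Qcoh (ground K)) (Qcoh A) := tensor_functor A.

Section HomK.
Context (K : comPzRingType) (A : kalgebra K) (M N : lmodType A).

(* K acts on A-modules through alg_map A. *)
Record homK := HomK {
  hk_fun :> M -> N;
  hkD : forall x y, hk_fun (x + y) = hk_fun x + hk_fun y;
  hkZ : forall k x, hk_fun (alg_map A k *: x) = alg_map A k *: hk_fun x }.

HB.instance Definition _ := gen_eqMixin homK.
HB.instance Definition _ := gen_choiceMixin homK.

Lemma homK_ext (f g : homK) : f =1 g -> f = g.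
Proof.
case: f g => [f f1 f2] [g g1 g2] /= /funext fg; case: _ / fg in g1 g2 *.
by congr HomK; exact: Prop_irrelevance.
Qed.

Program Definition homK_zero : homK := @HomK (fun=> 0) _ _.
Next Obligation. by move=> * /=; rewrite addr0. Qed.
Next Obligation. by move=> * /=; rewrite scaler0. Qed.
Program Definition homK_add (f g : homK) : homK := @HomK (fun m => f m + g m) _ _.
Next Obligation. by move=> f g x y /=; rewrite !hkD addrACA. Qed.
Next Obligation. by move=> f g k x /=; rewrite !hkZ scalerDr. Qed.
Program Definition homK_opp (f : homK) : homK := @HomK (fun m => - f m) _ _.
Next Obligation. by move=> f x y /=; rewrite hkD opprD. Qed.
Next Obligation. by move=> f k x /=; rewrite hkZ scalerN. Qed.
Program Definition homK_scale (a : A) (f : homK) : homK :=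
  @HomK (fun m => a *: f m) _ _.
Next Obligation. by move=> a f x y /=; rewrite hkD scalerDr. Qed.
Next Obligation. by move=> a f k x /=; rewrite hkZ !scalerA alg_central. Qed.
Program Definition homK_ract (f : homK) (b : A) : homK :=
  @HomK (fun m => f (b *: m)) _ _.
Next Obligation. by move=> f b x y /=; rewrite scalerDr hkD. Qed.
Next Obligation. by move=> f b k x /=; rewrite scalerA -alg_central -scalerA hkZ. Qed.

Fact homK_addA : associative homK_add.
Proof. by move=> f g h; apply: homK_ext => m /=; rewrite addrA. Qed.
Fact homK_addC : commutative homK_add.
Proof. by move=> f g; apply: homK_ext => m /=; rewrite addrC. Qed.
Fact homK_add0 : left_id homK_zero homK_add.
Proof. by move=> f; apply: homK_ext => m /=; rewrite add0r. Qed.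
Fact homK_addN : left_inverse homK_zero homK_opp homK_add.
Proof. by move=> f; apply: homK_ext => m /=; rewrite addNr. Qed.

HB.instance Definition _ :=
  GRing.isZmodule.Build homK homK_addA homK_addC homK_add0 homK_addN.

Fact homK_scaleA a b f : homK_scale a (homK_scale b f) = homK_scale (a * b) f.
Proof. by apply: homK_ext => m /=; rewrite scalerA. Qed.
Fact homK_scale1 : left_id 1 homK_scale.
Proof. by move=> f; apply: homK_ext => m /=; rewrite scale1r. Qed.
Fact homK_scaleDr : right_distributive homK_scale +%R.
Proof. by move=> a f g; apply: homK_ext => m /=; rewrite scalerDr. Qed.
Fact homK_scaleDl f : {morph homK_scale^~ f : a b / a + b}.
Proof. by move=> a b; apply: homK_ext => m /=; rewrite scalerDl. Qed.

HB.instance Definition _ := GRing.Zmodule_isLmodule.Build A homK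
  homK_scaleA homK_scale1 homK_scaleDr homK_scaleDl.

Program Definition Hom_K : bimod A := @Bimod K A homK homK_ract _ _ _ _ _ _.
Next Obligation. by move=> f g a; exact: homK_ext. Qed.
Next Obligation.
by move=> f a b; apply: homK_ext => m /=; rewrite scalerDl hkD.
Qed.
Next Obligation. by move=> f a b; apply: homK_ext => m /=; rewrite scalerA. Qed.
Next Obligation. by move=> f; apply: homK_ext => m /=; rewrite scale1r. Qed.
Next Obligation. by move=> a f b; exact: homK_ext. Qed.
Next Obligation. by move=> k f; apply: homK_ext => m /=; rewrite hkZ. Qed.

End HomK.

Section Differential.
Context (K : comPzRingType) (A : kalgebra K).

Definition center (F : bimod A) : set F :=
  [set x | forall a : A, a *: x = ract x a].
Arguments center : clear implicits.

Program Definition gen_sub (F : bimod A) (S : set F) : subbimod F :=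
  @SubBimod _ _ F [set x | forall U : subbimod F, S `<=` U -> U x] _ _ _ _.
Next Obligation. by move=> F S U _; exact: sb0. Qed.
Next Obligation. by move=> F S x y Sx Sy U SU; apply: sbD; [exact: Sx|exact: Sy]. Qed.
Next Obligation. by move=> F S a x Sx U SU; apply: sbZ; exact: Sx. Qed.
Next Obligation. by move=> F S a x Sx U SU; apply: sbR; exact: Sx. Qed.

Program Definition zero_sub (F : bimod A) : subbimod F :=
  @SubBimod _ _ F [set 0] _ _ _ _.
Next Obligation. by move=> F x y -> ->; rewrite addr0. Qed.
Next Obligation. by move=> F a x ->; rewrite scaler0. Qed.
Next Obligation. by move=> F a x ->; rewrite ract0. Qed.

Program Definition preim_sub (F G : bimod A) (f : bimod_hom F G) (U : subbimod G) :
  subbimod F := @SubBimod _ _ F (f @^-1` U) _ _ _ _.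
Next Obligation. by move=> F G f U; rewrite /preimage /= bm_fun0; exact: sb0. Qed.
Next Obligation.
by move=> F G f U x y; rewrite /preimage /= bm_funD; exact: sbD.
Qed.
Next Obligation. by move=> F G f U a x; rewrite /preimage /= bm_funZ; exact: sbZ. Qed.
Next Obligation. by move=> F G f U a x; rewrite /preimage /= bm_ract; exact: sbR. Qed.

(* Indices are shifted by one: diff_lt F p is the (p-1)-st term, starting    *)
(* from the term of index -1. The sub-bimodules of F containing U correspond   *)
(* to those of F / U by taking preimages.                                      *)
Fixpoint diff_lt (F : bimod A) (p : nat) : subbimod F :=
  if p is p'.+1 then
    preim_sub (quot_proj (diff_lt F p'))
      (gen_sub (center (quot_bimod (diff_lt F p'))))
  else zero_sub F.

Definition diff_filt (F : bimod A) (p : nat) : subbimod F := diff_lt F p.+1.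

Definition Diff_p (M N : lmodType A) (p : nat) : subbimod (Hom_K M N) :=
  diff_filt (Hom_K M N) p.

Definition Diff (M N : lmodType A) : set (Hom_K M N) :=
  \bigcup_p (Diff_p M N p : set _).

End Differential.

Arguments center {K A} F _.
Arguments gen_sub {K A F} S.
Arguments Diff {K A} M N _.

(* A right adjoint of the pullback exists: it sends a bimodule to its centre.  *)
Section CenterFunctor.
Context (K : comPzRingType) (A : kalgebra K).

Section Object.
Context (F : bimod A).

Definition cen_mem : {pred F} := [pred x | `[< center F x >]].
Lemma cen_memP x : reflect (center F x) (x \in cen_mem).
Proof. exact: asboolP. Qed.

Lemma cen_mem_closed : zmod_closed cen_mem.
Proof.
split=> [|x y /cen_memP Zx /cen_memP Zy]; apply/cen_memP => a.
  by rewrite scaler0 ract0.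
by rewrite scalerBr ractDl ractN Zx Zy.
Qed.
HB.instance Definition _ := GRing.isZmodClosed.Build F cen_mem cen_mem_closed.

Record cen_sort := CenSort { cen_val : F; cen_valP : cen_val \in cen_mem }.
HB.instance Definition _ := [isSub for cen_val].
HB.instance Definition _ := [Choice of cen_sort by <:].
HB.instance Definition _ := [SubChoice_isSubZmodule of cen_sort by <:].

Lemma cen_val_inj : injective cen_val. Proof. exact: val_inj. Qed.
Lemma cen_valC (x : cen_sort) (a : A) : a *: cen_val x = ract (cen_val x) a.
Proof. by have /cen_memP := cen_valP x; apply. Qed.

Lemma cen_scale_subproof (k : K) (x : cen_sort) :
  alg_map A k *: cen_val x \in cen_mem.
Proof.
apply/cen_memP => a.
by rewrite scalerA -alg_central -scalerA cen_valC ract_scale.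
Qed.
Definition cen_scale (k : K) (x : cen_sort) : cen_sort :=
  CenSort (cen_scale_subproof k x).

Fact cen_scaleA k l x : cen_scale k (cen_scale l x) = cen_scale (k * l) x.
Proof. by apply: cen_val_inj => /=; rewrite rmorphM scalerA. Qed.
Fact cen_scale1 : left_id 1 cen_scale.
Proof. by move=> x; apply: cen_val_inj => /=; rewrite rmorph1 scale1r. Qed.
Fact cen_scaleDr : right_distributive cen_scale +%R.
Proof. by move=> k x y; apply: cen_val_inj => /=; rewrite scalerDr. Qed.
Fact cen_scaleDl x : {morph cen_scale^~ x : k l / k + l}.
Proof. by move=> k l; apply: cen_val_inj => /=; rewrite rmorphD scalerDl. Qed.
HB.instance Definition _ := GRing.Zmodule_isLmodule.Build K cen_sort
  cen_scaleA cen_scale1 cen_scaleDr cen_scaleDl.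

Program Definition center_bimod : bimod (ground K) :=
  @Bimod K (ground K) cen_sort (fun x k => cen_scale k x) _ _ _ _ _ _.
Next Obligation. by move=> x y k; exact: cen_scaleDr. Qed.
Next Obligation. by move=> x k l; exact: cen_scaleDl. Qed.
Next Obligation. by move=> x k l /=; rewrite cen_scaleA [l * k]mulrC. Qed.
Next Obligation. by move=> x; exact: cen_scale1. Qed.
Next Obligation.
move=> k x l; change (cen_scale l (cen_scale k x) = cen_scale k (cen_scale l x)).
by rewrite !cen_scaleA mulrC.
Qed.

End Object.

Program Definition center_map (F G : bimod A) (f : bimod_hom F G) :
    bimod_hom (center_bimod F) (center_bimod G) :=
  @BimodHom _ _ (center_bimod F) (center_bimod G)
    (fun x => @CenSort G (f (cen_val x)) _) _ _.
Next Obligation.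
by move=> F G f x; apply/cen_memP => a; rewrite -bm_funZ cen_valC bm_ract.
Qed.
Next Obligation.
by move=> F G f k x y; apply: cen_val_inj; rewrite /= bm_funD bm_funZ.
Qed.
Next Obligation. by move=> F G f x k; apply: cen_val_inj; rewrite /= bm_funZ. Qed.

Definition pushforward : functor (Qcoh A) (Qcoh (ground K)).
Proof.
refine (@Functor (Qcoh A) (Qcoh (ground K)) center_bimod center_map _ _).
- by move=> F; apply: bimod_hom_ext => x; exact: cen_val_inj.
- by move=> F G H g f; apply: bimod_hom_ext => x; exact: cen_val_inj.
Defined.

Section Counit.
Context (F : bimod A).

Lemma counit_balanced :
  balanced (fun s : A * center_bimod F => s.1 *: cen_val s.2).
Proof.
split=> /= [a b v|a v w|a k v]; first by rewrite scalerDl.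
  by rewrite -scalerDr.
by rewrite -scalerA.
Qed.

Definition center_counit_fun : tensor A (center_bimod F) -> F :=
  plift (fun s => s.1 *: cen_val s.2).
Lemma center_counit_tens a v : center_counit_fun (tens a v) = a *: cen_val v.
Proof. exact: (plift_gen counit_balanced (a, v)). Qed.
Lemma center_counitD : {morph center_counit_fun : x y / x + y}.
Proof. by move=> x y; exact: (pliftD counit_balanced x y). Qed.

Program Definition center_counit :
    bimod_hom (tensor_bimod A (center_bimod F)) F :=
  @BimodHom _ _ (tensor_bimod A (center_bimod F)) F center_counit_fun _ _.
Next Obligation.
move=> a x y; rewrite center_counitD; congr (_ + _).
move: x; apply: tensor_ext => [x y'|x y'|c v].
- by rewrite scalerDr center_counitD.
- by rewrite center_counitD scalerDr.
- by rewrite tens_scale !center_counit_tens scalerA.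
Qed.
Next Obligation.
move=> x a; move: x; apply: tensor_ext => [x y'|x y'|c v].
- by rewrite ractDl center_counitD.
- by rewrite center_counitD ractDl.
- by rewrite [ract _ _]tensor_ract_tens !center_counit_tens ract_scale
    -cen_valC scalerA.
Qed.
End Counit.

Program Definition center_unit (V : bimod (ground K)) :
    bimod_hom V (center_bimod (tensor_bimod A V)) :=
  @BimodHom _ _ V (center_bimod (tensor_bimod A V))
    (fun v => @CenSort (tensor_bimod A V) (tens 1 v) _) _ _.
Next Obligation.
by move=> V v; apply/cen_memP => a; rewrite [RHS]tensor_ract_tens tens_scale
  mul1r mulr1.
Qed.
Next Obligation.
move=> V k v w; apply: cen_val_inj; rewrite /= tensDr; congr (_ + _).
by rewrite -tens_mid tens_scale mulr1 mul1r.
Qed.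
Next Obligation.
move=> V v k; apply: cen_val_inj; rewrite /= -[ract v k](bm_symm k v).
by rewrite -tens_mid tens_scale mulr1 mul1r.
Qed.

Definition center_adjunction : adjunction (pullback A) pushforward.
Proof.
refine (@Adjunction (Qcoh A) (Qcoh (ground K)) (pullback A) pushforward
  center_unit center_counit _ _ _ _).
- move=> V V' f; apply: bimod_hom_ext => v; apply: cen_val_inj => /=.
  by rewrite tensor_map_tens.
- move=> F G f; apply: bimod_hom_ext; apply: tensor_ext => [x y|x y|a v] /=.
  + by rewrite center_counitD bm_funD.
  + by rewrite tensor_mapD center_counitD.
  + by rewrite tensor_map_tens !center_counit_tens bm_funZ.
- move=> V; apply: bimod_hom_ext; apply: tensor_ext => [x y|x y|a v] //=.
  + by rewrite tensor_mapD center_counitD.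
  + by rewrite tensor_map_tens center_counit_tens tens_scale mulr1.
- move=> F; apply: bimod_hom_ext => v; apply: cen_val_inj => /=.
  by rewrite center_counit_tens scale1r.
Defined.

End CenterFunctor.

(* Main.v *)
Require Import Defs.
From mathcomp Require Import all_boot all_algebra.
From mathcomp Require Import boolp classical_sets.
Import GRing.Theory.
Local Open Scope ring_scope.
Local Open Scope classical_set_scope.

(** Both filtrations of a bimodule F are built by the same step.  Passing from
    F^p to F^{p+1} divides out the image of the counit f^* f_* F^p -> F^p, and
    passing from F / F_{p-1}^diff to F / F_p^diff divides out the sub-bimodule
    generated by the centre; these two sub-bimodules agree for every bimodule X
    ([range_counit]).  Indeed A (x) V is generated by the central elements
    1 (x) v, so every map A (x) V -> X, the counit among them, lands in what the
    centre of X generates.  Conversely the evaluation A (x) Z(X) -> X hits all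
    of the centre and, like every map out of an object f^* V, factors through
    the counit.

    Hence F^p is F modulo the (p-1)-st differential sub-bimodule.  The
    two quotients of F need only be compared through their kernels: what the
    centre of a quotient generates, pulled back to F, depends only on the kernel
    of the projection ([gen_center_quotient]), so induction on p shows that the
    projection F -> F^p has kernel F_{p-1}^diff ([tower_map_kernel]), that is
    F_p = F_p^diff.

    The colimit of the F_p is then their union: every element of a sequential
    colimit already comes from one stage ([bcolim_in_surj]), and the maps of the
    stages into F are injective, so the induced map from the colimit is
    injective too ([bcolim_desc_inj]). *)

Section Generated.
Context {K : comPzRingType} {A : kalgebra K}.

Lemma gen_sub_incl (F : bimod A) (S : set F) : S `<=` gen_sub S.
Proof. by move=> x Sx U SU; exact: SU. Qed.

(** The right-hand side mentions f only through its kernel: this is what makes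
    it possible to compare two presentations of the same quotient of F. *)
Lemma gen_center_quotient {F G : bimod A} (f : bimod_hom F G) (x : F) :
  (forall y, exists z, f z = y) ->
  gen_sub (center G) (f x) <->
  gen_sub [set z : F | forall a, f (a *: z - ract z a) = 0] x.
Proof.
move=> f_surj; set S := [set z : F | _]; split=> [Gfx|Sx].
  have cenS : center G `<=` Defs.image_sub (bimod_comp f (sub_incl (gen_sub S))).
    move=> y cy; have [z fz] := f_surj y.
    have Sz : S z.
      by move=> a; rewrite bm_funB bm_funZ bm_ract fz (cy a) subrr.
    have zS : z \in sb_mem (gen_sub S) by apply/sb_memP; exact: gen_sub_incl.
    by exists (SbSort zS).
  have [w _ fw] := Gfx _ cenS.
  (* x differs from an element of the generated sub-bimodule by an element of *)
  (* the kernel of f, and S contains that kernel                              *)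
  rewrite -(subrK (sb_val w) x); apply: sbD; last exact/sb_memP/sb_valP.
  have fxw : f (x - sb_val w) = 0 by rewrite bm_funB -fw subrr.
  apply: gen_sub_incl => a.
  by rewrite bm_funB bm_funZ bm_ract fxw scaler0 ract0 subrr.
apply: (Sx (preim_sub f (gen_sub (center G)))) => z Sz.
apply: gen_sub_incl => a; apply/eqP.
by rewrite -subr_eq0 -bm_funZ -bm_ract -bm_funB Sz.
Qed.

(** A (x) V is generated as a left module by the central elements 1 (x) v. *)
Lemma range_tensor_hom (V : bimod (ground K)) (X : bimod A)
    (h : bimod_hom (tensor_bimod A V) X) t :
  gen_sub (center X) (h t).
Proof.
pose U := preim_sub h (gen_sub (center X)).
have Utens a v : U (tens a v).
  rewrite -[a]mulr1 -tens_scale; apply: sbZ; apply: gen_sub_incl => b.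
  rewrite -bm_funZ -bm_ract; congr (h _).
  by rewrite [RHS]tensor_ract_tens tens_scale mulr1 mul1r.
have UN x : U x -> U (- x) by move=> Ux; rewrite -scaleN1r; exact: sbZ.
suff: U t by [].
elim/pres_ind: t => w; rewrite -weval_pgen; elim: w => [|[b [a v]] w IHw].
  by rewrite weval_nil; exact: sb0.
rewrite -cat1s weval_cat; apply: sbD => //.
rewrite /weval big_seq1 /=; case: b; last exact: Utens.
by apply: UN; exact: Utens.
Qed.

End Generated.

Section Adjunction.
Context {K : comPzRingType} {A : kalgebra K}.
Context {R : functor (Qcoh A) (Qcoh (ground K))}.
Context (adj : adjunction (pullback A) R).

(** h is the counit after f^* of its transpose, so s is the image of t under
    f^* of the transpose. *)
Lemma counit_factor (V : bimod (ground K)) (X : bimod A)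
    (h : bimod_hom (tensor_bimod A V) X) t :
  exists s, (counit adj X : bimod_hom _ _) s = h t.
Proof.
pose LRh := fmap (pullback A) (fmap R (h : @Defs.hom (Qcoh A) (pullback A V) X)).
pose Lu := fmap (pullback A) (unit_ adj V).
exists ((LRh : bimod_hom _ _) ((Lu : bimod_hom _ _) t)).
have counitE s : (counit adj X : bimod_hom _ _) ((LRh : bimod_hom _ _) s) =
    h ((counit adj (pullback A V) : bimod_hom _ _) s).
  symmetry; exact: (congr1 (fun g : bimod_hom _ _ => g s)
    (counit_nat adj (h : @Defs.hom (Qcoh A) (pullback A V) X))).
rewrite counitE; congr (h _).
exact: (congr1 (fun g : bimod_hom _ _ => g t) (triangleL adj V)).
Qed.

(** For the inclusion from right to left, a central z is the value of the
    evaluation A (x) Z(X) -> X at 1 (x) z. *)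
Lemma range_counit (X : bimod A) (x : X) :
  range (counit adj X : bimod_hom _ X) x <-> gen_sub (center X) x.
Proof.
split=> [[t _ <-]|Gx]; first exact: range_tensor_hom.
apply: (Gx (Defs.image_sub (counit adj X : bimod_hom _ X))) => z cz.
have zZ : z \in @cen_mem K A X by apply/cen_memP.
have [s sE] := counit_factor _ _ (center_counit X)
  (@tens K A (center_bimod X) 1 (CenSort zZ)).
by exists s; rewrite // sE /= center_counit_tens scale1r.
Qed.

Lemma tower_map_surj (F : bimod A) p :
  forall y, exists z, (tower_map adj F p : bimod_hom F _) z = y.
Proof.
elim: p => [|p IHp] y; first by exists y.
move: y; apply: quot_ind => y; have [z <-] := IHp y.
by exists z.
Qed.

(** By induction on p, dividing out the counit adds to the kernel exactly what
    the centre of F^p generates; [gen_center_quotient] for F -> F^p and for the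
    projection modulo [diff_lt F p], which have the same kernel, identifies this
    with the next differential sub-bimodule. *)
Lemma tower_map_kernel (F : bimod A) p (x : F) :
  (tower_map adj F p : bimod_hom F _) x = 0 <-> diff_lt F p x.
Proof.
elim: p x => [|p IHp] x //.
set t := (tower_map adj F p : bimod_hom F _).
set im := Defs.image_sub (counit adj (tower adj F p) : bimod_hom _ _).
have tower_next : (tower_map adj F p.+1 : bimod_hom F _) x = 0 <-> im (t x).
  change (quot_pi im (t x) = 0 <-> im (t x)).
  by rewrite -(quot_pi0 im) quot_piP subr0.
rewrite tower_next /im -[Defs.image_sub _ _]/(range _ _) range_counit.
rewrite (gen_center_quotient t x (tower_map_surj F p)).
have proj_surj y : exists z, quot_proj (diff_lt F p) z = y.
  by exists (repr y); exact: quot_reprK.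
rewrite -[diff_lt F p.+1 x]/(gen_sub _ (quot_proj (diff_lt F p) x)).
rewrite (gen_center_quotient _ x proj_surj).
have ker_proj z : quot_proj (diff_lt F p) z = 0 <-> t z = 0.
  change (quot_pi (diff_lt F p) z = 0 <-> t z = 0).
  by rewrite -(quot_pi0 (diff_lt F p)) quot_piP subr0 IHp.
have -> // : [set z : F | forall a, t (a *: z - ract z a) = 0] =
  [set z : F | forall a, quot_proj (diff_lt F p) (a *: z - ract z a) = 0].
by apply/seteqP; split=> z Sz a; apply/ker_proj.
Qed.

End Adjunction.

Section Colimit.
Context {K : comPzRingType} {A : kalgebra K}.
Context {D : nat -> bimod A} {d : forall n, bimod_hom (D n) (D n.+1)}.

Lemma bcolim_in_shift n k (x : D n) :
  exists y : D (k + n)%N, bcolim_in d y = bcolim_in d x.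
Proof.
elim: k => [|k [y <-]]; first by exists x.
by exists (d _ y); exact: bcolim_in_step.
Qed.

Lemma bcolim_in_surj (q : bcolim d) : exists n (x : D n), q = bcolim_in d x.
Proof.
elim/pres_ind: q => w; rewrite -weval_pgen; elim: w => [|[b [m y]] w [n [x E]]].
  by exists 0%N, 0; rewrite weval_nil; exact: (esym (bm_fun0 (bcolim_in_hom d 0%N))).
rewrite -cat1s weval_cat E /weval big_seq1 /=.
have -> : (if b then - pgen (cocone d) (existT _ m y) else
    pgen (cocone d) (existT _ m y)) = bcolim_in d (if b then - y else y).
  by case: b => //; rewrite -scaleN1r bcolim_inZ scaleN1r.
(* both summands are moved to the stage n + m before being added *)
have [y' <-] := bcolim_in_shift m n (if b then - y else y).
have [x' <-] := bcolim_in_shift n m x.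
rewrite addnC in x' *.
by exists (n + m)%N, (y' + x'); rewrite bcolim_inD.
Qed.

(** An element of the kernel comes from some stage, where injectivity already
    makes it vanish. *)
Lemma bcolim_desc_inj (Z : bimod A) (g : forall n, bimod_hom (D n) Z)
    (gd : forall n, bimod_comp (g n.+1) (d n) = g n) :
  (forall n, injective (g n)) -> injective (bcolim_desc gd).
Proof.
move=> g_inj q1 q2 /eqP; rewrite -subr_eq0 -bm_funB => /eqP q0.
apply/eqP; rewrite -subr_eq0; apply/eqP; move: q0.
have [n [x ->]] := bcolim_in_surj (q1 - q2).
rewrite /= bcolim_desc_in // -(bm_fun0 (g n)) => /g_inj ->.
exact: (bm_fun0 (bcolim_in_hom d n)).
Qed.

End Colimit.

Theorem proposition8 (K : comPzRingType) (A : kalgebra K) (M N : lmodType A)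
    (f_lower_star : functor (Qcoh A) (Qcoh (ground K)))
    (adj : adjunction (pullback A) f_lower_star) :
  let F := Hom_K M N in
  let incl : bimod_hom (filt_colim adj F) F := filt_colim_map adj F in
  injective incl /\ range incl = Diff M N.
Proof.
move=> F incl; split.
  apply: bcolim_desc_inj => n; exact: sb_val_inj.
have inclE n (x : filt adj F n : bimod A) :
    incl (bcolim_in (filt_step adj F) x) = (filt_map adj F n : bimod_hom _ _) x.
  exact: (bcolim_desc_in (filt_stepK adj F) x).
apply/seteqP; split=> [_ [q _ <-]|f [p _ Dfp]].
  have [n [x ->]] := bcolim_in_surj (d := filt_step adj F) q.
  rewrite inclE; exists n => //; apply/(tower_map_kernel adj F n.+1).
  exact: (elimT (sb_memP _ _) (sb_valP x)).
have fK : f \in sb_mem (kernel_sub (tower_map adj F p.+1)).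
  by apply/sb_memP/(tower_map_kernel adj F p.+1).
by exists (bcolim_in (filt_step adj F) (SbSort fK : filt adj F p : bimod A)) => //.
Qed.
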